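(* Let $m,\tilde m\in\mathbb{N}$ with $m\le\tilde m$ and $m+\tilde m\in2\mathbb{N}$, and let $p\in\mathbb{N}_0$. Let $z\in\mathbb{C}$ with $|z|=1$, and let $$X(z)=\begin{pmatrix}\mathcal{A}(z)&\mathcal{A}(-z)\\ b(z)\,Id_{p+1}&b(-z)\,Id_{p+1}\end{pmatrix}$$ be the modulation matrix of the quark vector $\Phi=(\varphi_0,\dots,\varphi_p)^T$ and the quarklet vector $\Psi=(\psi_0,\dots,\psi_p)^T$. Then $X(z)$ is invertible and $$X(z)^{-1}=\overline{\tilde X(z)}^T=\begin{pmatrix}\overline{\tilde{\mathcal{A}}(z)}^T&\overline{\tilde{\mathcal{B}}(z)}^T\\ \overline{\tilde{\mathcal{A}}(-z)}^T&\overline{\tilde{\mathcal{B}}(-z)}^T\end{pmatrix},$$ where $$\overline{\tilde{\mathcal{A}}(z)}^T=b(-z)T(z)^{-1},\qquad\overline{\tilde{\mathcal{B}}(z)}^T=-T(z)^{-1}\mathcal{A}(-z).$$ In other words, the perfect reconstruction condition $X(z)\overline{\tilde X(z)}^T=Id_{2p+2}$ is fulfilled. Moreover there exist finitely supported sequences of $(p+1)\times(p+1)$ matrices $\{\tilde A_k\}_{k\in\mathbb{Z}}$ and $\{\tilde B_k\}_{k\in\mathbb{Z}}$ such that $$\tilde{\mathcal{A}}(z)=\frac12\sum_{k\in\mathbb{Z}}\tilde A_kz^k,\qquad\tilde{\mathcal{B}}(z)=\frac12\sum_{k\in\mathbb{Z}}\tilde B_kz^k .$$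
   Context: $\mathbb{N}=\{1,2,\dots\}$, $\mathbb{N}_0=\mathbb{N}\cup\{0\}$; $Id_n$ is the $n\times n$ identity matrix. Cardinal B-splines: $N_1=\chi_{[0,1)}$, $N_m(x)=\int_0^1N_{m-1}(x-t)\,dt$ for $m>1$. Quarks: $\varphi_q(x)=(x/\lceil m/2\rceil)^qN_m(x+\lfloor m/2\rfloor)$, $q\in\mathbb{N}_0$. Coefficients $b_k$: put $K=(m+\tilde m)/2$ and for $|z|=1$ let $\tilde a(z)=z^{-\lfloor\tilde m/2\rfloor}\big(\tfrac{1+z}{2}\big)^{\tilde m}\sum_{n=0}^{K-1}\binom{K-1+n}{n}\big(\tfrac{2-z-z^{-1}}{4}\big)^n$ (symbol of the Cohen--Daubechies--Feauveau dual generator). The finitely supported real sequence $(b_k)_{k\in\mathbb{Z}}$ of coefficients of the CDF spline wavelet $\sum_kb_k\varphi_0(2\cdot-k)$ is determined by $b(z):=\frac12\sum_kb_kz^k=-z\,\overline{\tilde a(-z)}$ for $|z|=1$ (equivalently $b(-z)=z\overline{\tilde a(z)}$). Quarklets: $\psi_q=\sum_kb_k\varphi_q(2\cdot-k)$. Refinement matrices: $A_k$ is the $(p+1)\times(p+1)$ matrix with entries $(A_k)_{q,l}=2^{1-q}\lceil m/2\rceil^{l-q}a_k\binom{q-1}{l-1}k^{q-l}$, $q,l\in\{1,\dots,p+1\}$, where $a_k=2^{1-m}\binom{m}{k+\lfloor m/2\rfloor}$ for $-\lfloor m/2\rfloor\le k\le\lceil m/2\rceil$ and $a_k=0$ otherwise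 (entries with $l>q$ are $0$, and $0^0=1$). One has $\Phi=\sum_kA_k\Phi(2\cdot-k)$. Put $\mathcal{A}(z)=\frac12\sum_kA_kz^k$ and $T(z)=\mathcal{A}(z)b(-z)-b(z)\mathcal{A}(-z)$. It is known that $T(z)$ is invertible for $|z|=1$. *)

(* Defs.v *)
From HB Require Import structures.
From mathcomp Require Export all_boot all_order all_algebra complex spectral.
From mathcomp Require Export classical_sets cardinality fsbigop reals.
From mathcomp Require Import ring.

Set Implicit Arguments.
Unset Strict Implicit.
Unset Printing Implicit Defensive.

Import Order.TTheory GRing.Theory Num.Theory.
Local Open Scope classical_set_scope.
Local Open Scope sesquilinear_scope.
Local Open Scope ring_scope.

Definition finitely_supported (V : zmodType) (u : int -> V) : Prop :=
  finite_set [set k | u k != 0].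

Section Symbols.
Variable C : numClosedFieldType.

(* The sums range over all integers; they are the genuine ones whenever u,
   resp. M, is finitely supported (fsbigop sums are 0 on infinite supports). *)
Definition symbol (u : int -> C) (z : C) : C :=
  2^-1 * \sum_(k \in [set: int]) u k * z ^ k.

Definition mx_symbol (n : nat) (M : int -> 'M[C]_n) (z : C) : 'M[C]_n :=
  2^-1 *: \sum_(k \in [set: int]) (z ^ k *: M k).

End Symbols.

Section QuarkletSymbols.
Variable R : realType.
Local Notation C := R[i].

(* Symbol of the Cohen-Daubechies-Feauveau dual generator; here
   K = (m + mt) / 2, and K.-1 + n is the upper index of the binomial. *)
Definition cdf_dual_symbol (m mt : nat) (z : C) : C :=
  let K := (m + mt)./2 in
  z ^ (- (mt./2)%:Z) * ((1 + z) / 2) ^+ mt *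
  \sum_(n < K) 'C(K.-1 + n, n)%:R * ((2 - z - z^-1) / 4) ^+ n.

(* A Laurent polynomial is determined by its values on the unit circle, so at
   most one sequence b satisfies this predicate for given m and mt; see
   cdf_wavelet_mask_exists below for its existence. *)
Definition is_cdf_wavelet_mask (m mt : nat) (b : int -> R) : Prop :=
  finitely_supported b /\
  forall z : C, `|z| = 1 ->
    symbol (fun k => (b k)%:C%C) z = - z * (cdf_dual_symbol m mt (- z))^*.

Definition spline_mask (m : nat) (k : int) : R :=
  if - (m./2)%:Z <= k <= (uphalf m)%:Z
  then 2 ^ (1 - m%:Z) * 'C(m, absz (k + (m./2)%:Z))%:R
  else 0.

(* Rows and columns are numbered from 0: i = q - 1 and j = l - 1.  Entries
   above the diagonal vanish because of the binomial coefficient. *)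
Definition quark_mask (m p : nat) (k : int) : 'M[C]_p.+1 :=
  \matrix_(i, j)
    (2 ^ (- i%:Z) * (uphalf m)%:R ^ (j%:Z - i%:Z) * spline_mask m k *
     'C(i, j)%:R * k%:~R ^ (i%:Z - j%:Z))%:C%C.

Section Modulation.
Variables (m p : nat) (b : int -> R).

Definition quark_symbol (z : C) : 'M[C]_p.+1 := mx_symbol (quark_mask m p) z.

Definition quarklet_symbol (z : C) : C := symbol (fun k => (b k)%:C%C) z.

Definition Tmx (z : C) : 'M[C]_p.+1 :=
  quarklet_symbol (- z) *: quark_symbol z -
  quarklet_symbol z *: quark_symbol (- z).

Definition modulation_mx (z : C) : 'M[C]_(p.+1 + p.+1) :=
  block_mx (quark_symbol z) (quark_symbol (- z))
           (quarklet_symbol z)%:M (quarklet_symbol (- z))%:M.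

(* Since ^t* is an involution, the next two definitions say that the conjugate
   transposes are b(-z) T(z)^-1 and - T(z)^-1 A(-z). *)
Definition dual_quark_symbol (z : C) : 'M[C]_p.+1 :=
  (quarklet_symbol (- z) *: invmx (Tmx z)) ^t*.

Definition dual_quarklet_symbol (z : C) : 'M[C]_p.+1 :=
  (- (invmx (Tmx z) *m quark_symbol (- z))) ^t*.

Definition dual_modulation_mx (z : C) : 'M[C]_(p.+1 + p.+1) :=
  block_mx (dual_quark_symbol z) (dual_quark_symbol (- z))
           (dual_quarklet_symbol z) (dual_quarklet_symbol (- z)).

End Modulation.
End QuarkletSymbols.

Section Existence.
Variable R : realType.
Local Notation C := R[i].
Local Notation toC := (real_complex R).

(* Laurent polynomial functions with real coefficients on the unit circle. *)
Definition laurent (f : C -> C) : Prop := exists (N : nat) (P : {poly R}),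
  forall z : C, `|z| = 1 -> z ^+ N * f z = (map_poly toC P).[z].

Lemma laurentD f g : laurent f -> laurent g -> laurent (fun z => f z + g z).
Proof.
move=> [N [P HP]] [M [Q HQ]]; exists (N + M)%N, ('X^M * P + 'X^N * Q) => z z1.
rewrite rmorphD !rmorphM /= !map_polyXn !hornerE -HP // -HQ //.
by rewrite exprD; ring.
Qed.

Lemma laurentM f g : laurent f -> laurent g -> laurent (fun z => f z * g z).
Proof.
move=> [N [P HP]] [M [Q HQ]]; exists (N + M)%N, (P * Q) => z z1.
by rewrite rmorphM /= hornerM -HP // -HQ // exprD; ring.
Qed.

Lemma laurentC (c : R) : laurent (fun=> toC c).
Proof. by exists 0%N, c%:P => z _; rewrite map_polyC hornerC mul1r. Qed.

Lemma laurentX : laurent id.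
Proof. by exists 0%N, 'X => z _; rewrite map_polyX hornerX mul1r. Qed.

Lemma laurentV : laurent (fun z => z^-1).
Proof.
exists 1%N, 1 => z z1; rewrite rmorph1 hornerC mulfV //.
by rewrite -normr_eq0 z1 oner_eq0.
Qed.

Lemma eq_laurent f g : laurent f -> (forall z, `|z| = 1 -> f z = g z) -> laurent g.
Proof.
by move=> [N [P HP]] fg; exists N, P => z z1; rewrite -fg // HP.
Qed.

Lemma laurent_nat n : laurent (fun=> n%:R).
Proof. refine (eq_laurent (laurentC n%:R) _). by move => z _; rewrite rmorph_nat. Qed.

Lemma laurent_natV n : laurent (fun=> n%:R^-1).
Proof.
by apply: (eq_laurent (laurentC n%:R^-1)) => z _; rewrite fmorphV rmorph_nat.
Qed.

Lemma laurentN f : laurent f -> laurent (fun z => - f z).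
Proof.
move=> Lf; apply: (eq_laurent (laurentM (laurentC (-1)) Lf)) => z _.
by rewrite rmorphN1 mulN1r.
Qed.

Lemma laurentXn f n : laurent f -> laurent (fun z => f z ^+ n).
Proof.
move=> Lf; elim: n => [|n IH]; first exact: (laurent_nat 1).
by apply: (eq_laurent (laurentM Lf IH)) => z _; rewrite exprS.
Qed.

Lemma laurent_sum n (F : nat -> C -> C) :
  (forall i, laurent (F i)) -> laurent (fun z => \sum_(i < n) F i z).
Proof.
move=> LF; elim: n => [|n IH].
  by apply: (eq_laurent (laurent_nat 0)) => z _; rewrite big_ord0.
by apply: (eq_laurent (laurentD IH (LF n))) => z _; rewrite big_ord_recr.
Qed.

Lemma conj_cdf m mt (w : C) : `|w| = 1 ->
  (cdf_dual_symbol m mt w)^* = cdf_dual_symbol m mt w^-1.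
Proof.
move=> w1; have cw : w^* = w^-1 by rewrite invC_norm w1 expr1n invr1 mul1r.
rewrite /cdf_dual_symbol rmorphM rmorphM fmorphXz rmorphXn /= fmorph_div.
rewrite rmorphD rmorph1 rmorph_nat cw rmorph_sum /=.
congr (_ * _); first by rewrite cw.
apply: eq_bigr => i _.
rewrite rmorphM rmorph_nat rmorphXn /= fmorph_div !rmorphB /= fmorphV cw.
rewrite !rmorph_nat /= !cw.
by [].
Qed.

Lemma laurent_symbol f : laurent f -> exists b : int -> R,
  finitely_supported b /\
  forall z : C, `|z| = 1 -> symbol (fun k => (b k)%:C%C) z = f z.
Proof.
move=> [N [P HP]].
pose h (i : nat) : int := i%:Z - N%:Z.
pose b (k : int) : R := if k + N%:Z is Posz n then 2 * P`_n else 0.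
have hI : injective h by move=> i j /addIr [].
have bh i : b (h i) = 2 * P`_i by rewrite /b /h subrK.
have supp k : b k != 0 -> k \in [seq h i | i <- iota 0 (size P)].
  rewrite /b; case E: (k + N%:Z) => [n|n]; last by rewrite eqxx.
  move=> nz; apply/mapP; exists n; last by rewrite /h -E addrK.
  rewrite mem_iota /= add0n ltnNge; apply: contra nz => /(nth_default 0) ->.
  by rewrite mulr0.
exists b; split.
  apply: (sub_finite_set _ (finite_seq [seq h i | i <- iota 0 (size P)])).
  by move=> k /= /supp.
move=> z z1; have z0 : z != 0 by rewrite -normr_eq0 z1 oner_eq0.
rewrite /symbol.
rewrite -(fsbig_widen [set` [seq h i | i <- iota 0 (size P)]]) //; last first.
  move=> k /= [_ kN]; have [->|/supp //] := eqVneq (b k) 0.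
  by rewrite mul0r.
rewrite -fsbig_seq ?map_inj_uniq ?iota_uniq //.
rewrite big_map; apply: (mulfI (expf_neq0 N z0)); rewrite HP //.
rewrite horner_coef size_map_poly.
rewrite -(big_mkord xpredT (fun i => (map_poly toC P)`_i * z ^+ i)).
rewrite /index_iota subn0 mulrA mulr_sumr; apply: eq_bigr => i _.
rewrite bh coef_map /= rmorphM rmorph_nat /h expfzDr // -exprnN.
have -> : z ^ i = z ^+ i by [].
have zN : z ^+ N != 0 by rewrite expf_neq0.
by field.
Qed.

Lemma cdf_wavelet_mask_exists (m mt : nat) :
  exists b : int -> R, is_cdf_wavelet_mask m mt b.
Proof.
suff /laurent_symbol [b [fb Hb]] :
    laurent (fun z => - z * (cdf_dual_symbol m mt (- z))^*) by exists b.
have L : laurent (fun z => - z * cdf_dual_symbol m mt (- z^-1)).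
  apply: laurentM; first exact: (laurentN laurentX).
  rewrite /cdf_dual_symbol; apply: laurentM; first apply: laurentM.
  - apply: (eq_laurent (laurentXn mt./2 (laurentN laurentX))) => z z1.
    by rewrite -invrN -exprnN -exprVn invrK.
  - apply: laurentXn; apply: laurentM; last exact: (laurent_natV 2).
    exact: (laurentD (laurent_nat 1) (laurentN laurentV)).
  refine (@laurent_sum (m + mt)./2 (fun n z => 'C((m + mt)./2.-1 + n, n)%:R *
     ((2 - - z^-1 - (- z^-1)^-1) / 4) ^+ n) _) => n.
  apply: laurentM; first exact: laurent_nat.
  apply: laurentXn; apply: laurentM; last exact: (laurent_natV 4).
  apply: laurentD; first (apply: laurentD; first exact: laurent_nat).
    exact: (laurentN (laurentN laurentV)).
  apply: laurentN; apply: (eq_laurent (laurentN laurentX)) => z _.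
  by rewrite invrN invrK.
apply: (eq_laurent L) => z z1; rewrite conj_cdf ?normrN // invrN //.
Qed.
End Existence.

(* Main.v *)
From mathcomp Require Import zify ring.
Require Import Defs.
Set Implicit Arguments.
Unset Strict Implicit.
Unset Printing Implicit Defensive.

Import Order.TTheory GRing.Theory Num.Theory.
Local Open Scope sesquilinear_scope.
Local Open Scope ring_scope.

(** The modulation matrix is X = [[A, A'], [c 1, c' 1]] with A = A(z),
A' = A(-z), c = b(z), c' = b(-z), and T = c' A - c A'.  Since c and c' are
scalars, multiplying out shows that
[[c' T^-1, - T^-1 A'], [- c T^-1, T^-1 A]] is a left inverse of X as soon as T
is invertible: each block is T^-1 T, or a difference of two equal products
(block_left_inverse).  It is checked as a left inverse because A and A' need
not commute, so that the off-diagonal block A' T^-1 A - A T^-1 A' of the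
product in the other order has no evident reason to vanish; square matrices
have two-sided inverses, which gives the perfect reconstruction condition.  As
T(-z) = - T(z), the second block row of this inverse is its first block row at
- z, as the dual modulation matrix requires.

Everything thus rests on T.  The matrices A_k are lower triangular with
diagonal entries 2^-i a_k, i counted from 0.  Hence T(z) is lower triangular,
with diagonal entries
2^-i (a(z) b(-z) - b(z) a(-z)) = 2^-i z (a(z) e(z) + a(-z) e(-z)),
where a is the spline symbol and e the conjugate of the dual symbol.  With
y = (2 - z - 1/z) / 4 and x = 1 - y one finds
a(z) e(z) = x^K sum_(n < K) C(K-1+n, n) y^n (spline_cdf_product); replacing z
by - z exchanges x and y, and the two terms add up to 1 (problem_of_points).
So the diagonal entries of T(z) are 2^-i z, and det T(z) is a nonzero constant
times z^(p+1) (det_Tmx).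

This monomial determinant is also why the dual filters are finite: its inverse
is a Laurent monomial, so T^-1 = (det T)^-1 adj T has Laurent polynomial
entries.  On the unit circle conjugation replaces z by 1/z, so the adjoints
are Laurent polynomials too, and Laurent polynomials are symbols of finitely
supported sequences (laurent_mx_symbol). *)

(** * The Bezout identity behind the CDF filters *)

(** Multiplication by 1 - y takes backward differences of the coefficients, and
Pascal's rule turns these into the coefficients for a; the subtracted term is
the top coefficient left over at the truncation. *)
Lemma negbin_sum_step (A : comNzRingType) (x y : A) (a b : nat) :
  x + y = 1 ->
  x * (\sum_(n < b.+1) 'C(a.+1 + n, n)%:R * y ^+ n) =
  \sum_(n < b.+1) 'C(a + n, n)%:R * y ^+ n -
  'C(a.+1 + b, b)%:R * y ^+ b.+1.
Proof.
move=> xy; have -> : x = 1 - y by rewrite -xy addrK.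
elim: b => [|b IH]; first by rewrite !big_ord1 !bin0; ring.
rewrite big_ord_recr /= mulrDr IH [in RHS]big_ord_recr /=.
have -> : 'C(a.+1 + b.+1, b.+1) = ('C(a + b.+1, b.+1) + 'C(a.+1 + b, b))%N.
  by rewrite [in LHS]addSn binS addSnnS.
by rewrite natrD [y ^+ b.+2]exprS; ring.
Qed.

(** In a series of independent trials with success probability x, the summands
are the probabilities that the (a+1)-st success comes before the (b+1)-st
failure, and the reverse.  For the proof by induction on a, raising a by one
moves the single term C(a+1+b, b) x^(a+1) y^(b+1) from the first sum to the
second. *)
Lemma problem_of_points (A : comNzRingType) (x y : A) (a b : nat) :
  x + y = 1 ->
  x ^+ a.+1 * (\sum_(n < b.+1) 'C(a + n, n)%:R * y ^+ n) +
  y ^+ b.+1 * (\sum_(n < a.+1) 'C(b + n, n)%:R * x ^+ n) = 1.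
Proof.
move=> xy; elim: a => [|a IH].
  rewrite big_ord1 addn0 bin0 expr0 !mulr1 expr1.
  under eq_bigr do rewrite add0n binn mul1r.
  have -> : x = 1 - y by rewrite -xy addrK.
  elim: b => [|b IH]; first by rewrite big_ord1; ring.
  by rewrite big_ord_recr /= -[RHS]IH [y ^+ b.+2]exprS; ring.
rewrite exprSr -mulrA negbin_sum_step // [X in _ + _ * X]big_ord_recr /=.
have -> : 'C(b + a.+1, a.+1) = 'C(a.+1 + b, b).
  by rewrite addnC -[in RHS]bin_sub ?leq_addl // addnK.
by rewrite -[RHS]IH; ring.
Qed.

(** * Symbols as Laurent polynomials *)

(** Sums over the type of integers are only meaningful through an explicit
finite range; repetition-free sequences give access to ordinary big sums. *)
Lemma sum_int_seq (V : zmodType) (F : int -> V) (s : seq int) :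
  uniq s -> (forall k, k \notin s -> F k = 0) ->
  \sum_(k \in [set: int]%classic) F k = \sum_(k <- s) F k.
Proof.
move=> us sF; rewrite -(fsbig_widen [set` s]%classic) //; last first.
  by move=> k /= [_ ks]; apply: sF; apply/negP.
by rewrite -fsbig_seq.
Qed.

Lemma finitely_supported_seq (V : zmodType) (u : int -> V) :
  finitely_supported u ->
  exists s : seq int, uniq s /\ forall k, k \notin s -> u k = 0.
Proof.
move=> /finite_seqP [s us]; exists (undup s); split; first exact: undup_uniq.
move=> k; rewrite mem_undup => ks; apply/eqP; apply: contraNT ks => uk.
by have : [set` s]%classic k by rewrite -us.
Qed.

Lemma seq_finitely_supported (V : zmodType) (u : int -> V) (s : seq int) :
  (forall k, k \notin s -> u k = 0) -> finitely_supported u.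
Proof.
move=> su; apply: (sub_finite_set _ (finite_seq s)) => k /= uk.
by apply: contraNT uk => /su ->.
Qed.

Lemma mx_symbolE (C : numClosedFieldType) (n : nat) (M : int -> 'M[C]_n) z i j :
  finitely_supported M -> mx_symbol M z i j = symbol (fun k => M k i j) z.
Proof.
move=> /finitely_supported_seq [s [us sM]]; rewrite /mx_symbol /symbol.
rewrite !(sum_int_seq us); last 2 first.
- by move=> k /sM ->; rewrite mxE mul0r.
- by move=> k /sM ->; rewrite scaler0.
rewrite mxE summxE; congr (_ * _); apply: eq_bigr => k _.
by rewrite mxE mulrC.
Qed.

Section LaurentClosure.
Variable R : realType.
Local Notation C := R[i].
Implicit Types (f : C -> C).

Lemma unit_circle_neq0 (z : C) : `|z| = 1 -> z != 0.
Proof. by move=> z1; rewrite -normr_eq0 z1 oner_eq0. Qed.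

Lemma unit_circle_conj (z : C) : `|z| = 1 -> z^* = z^-1.
Proof. by move=> z1; rewrite invC_norm z1 expr1n invr1 mul1r. Qed.

Lemma laurent_bigsum (I : Type) (r : seq I) (P : pred I) (F : I -> C -> C) :
  (forall i, laurent (F i)) -> laurent (fun z => \sum_(i <- r | P i) F i z).
Proof.
move=> LF; elim: r => [|i r IH].
  by apply: (eq_laurent (laurent_nat R 0)) => z _; rewrite big_nil.
case Pi : (P i); last by apply: (eq_laurent IH) => z _; rewrite big_cons Pi.
by apply: (eq_laurent (laurentD (LF i) IH)) => z _; rewrite big_cons Pi.
Qed.

Lemma laurent_bigprod (I : Type) (r : seq I) (P : pred I) (F : I -> C -> C) :
  (forall i, laurent (F i)) -> laurent (fun z => \prod_(i <- r | P i) F i z).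
Proof.
move=> LF; elim: r => [|i r IH].
  by apply: (eq_laurent (laurent_nat R 1)) => z _; rewrite big_nil.
case Pi : (P i); last by apply: (eq_laurent IH) => z _; rewrite big_cons Pi.
by apply: (eq_laurent (laurentM (LF i) IH)) => z _; rewrite big_cons Pi.
Qed.

Lemma laurent_sign (n : nat) : laurent (fun _ : C => (-1) ^+ n).
Proof. exact/laurentXn/laurentN/(laurent_nat R 1). Qed.

Lemma laurent_horner f (P : {poly R}) :
  laurent f -> laurent (fun z => (map_poly (real_complex R) P).[f z]).
Proof.
move=> Lf; pose F i z := real_complex R P`_i * f z ^+ i.
have LF i : laurent (F i) by apply: laurentM (laurentC _) (laurentXn _ Lf).
apply: (eq_laurent (laurent_sum (size P) LF)) => z _.
rewrite horner_coef size_map_poly.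
by apply: eq_bigr => i _; rewrite coef_map.
Qed.

(** Multiplying by z^N in laurent is undone at - z by (- 1/z)^N, which leaves a
polynomial evaluated at the Laurent polynomial - z. *)
Lemma laurent_opp_arg f : laurent f -> laurent (fun z => f (- z)).
Proof.
move=> [N [P fP]].
apply: (eq_laurent (laurentM (laurentXn N (laurentN (laurentV R)))
                             (laurent_horner P (laurentN (laurentX R))))).
move=> z z1; rewrite -fP ?normrN // mulrA -exprMn mulrNN mulVf ?expr1n ?mul1r //.
exact: unit_circle_neq0.
Qed.

(** On the unit circle z^* = 1/z, and the coefficients are real. *)
Lemma laurent_conj f : laurent f -> laurent (fun z => (f z)^*).
Proof.
move=> [N [P fP]].
apply: (eq_laurent (laurentM (laurentXn N (laurentX R))
                             (laurent_horner P (laurentV R)))) => z z1.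
have cP : ((map_poly (real_complex R) P).[z])^* =
          (map_poly (real_complex R) P).[z^-1].
  rewrite !horner_coef rmorph_sum /=; apply: eq_bigr => i _.
  rewrite rmorphM rmorphXn /= (unit_circle_conj z1) coef_map /=.
  by congr (_ * _); exact: conjc_real.
rewrite -cP -fP // rmorphM rmorphXn /= (unit_circle_conj z1) mulrA -exprMn.
by rewrite mulfV ?expr1n ?mul1r // unit_circle_neq0.
Qed.

Lemma laurent_exprz (k : int) : laurent (fun z : C => z ^ k).
Proof.
case: k => n; first exact: (laurentXn n (laurentX R)).
apply: (eq_laurent (laurentXn n.+1 (laurentV R))) => z _.
by rewrite NegzE -exprnN exprVn.
Qed.

Lemma symbol_laurent (u : int -> R) :
  finitely_supported u -> laurent (symbol (fun k => (u k)%:C%C)).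
Proof.
move=> /finitely_supported_seq [s [us su]].
pose F (k : int) (z : C) := (u k)%:C%C * z ^ k.
have LF k : laurent (F k) by apply: laurentM (laurentC _) (laurent_exprz k).
apply: (eq_laurent (laurentM (laurent_natV R 2) (laurent_bigsum s xpredT LF))).
move=> z _; rewrite /symbol (sum_int_seq us) // => k /su ->.
by rewrite mul0r.
Qed.

Definition laurent_mx (n : nat) (F : C -> 'M[C]_n) :=
  forall i j, laurent (fun z => F z i j).

Lemma laurent_det n (F : C -> 'M[C]_n) :
  laurent_mx F -> laurent (fun z => \det (F z)).
Proof.
move=> LF; apply: laurent_bigsum => s.
exact: laurentM (laurent_sign _) (laurent_bigprod _ _ _).
Qed.

(** Taking the adjugate rather than the inverse avoids division. *)
Lemma laurent_adj n (F : C -> 'M[C]_n) :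
  laurent_mx F -> laurent_mx (fun z => \adj (F z)).
Proof.
move=> LF i j.
suff L : laurent (fun z => cofactor (F z) j i).
  by apply: (eq_laurent L) => z _; rewrite mxE.
apply: laurentM (laurent_sign _) (laurent_det _) => k l.
by apply: (eq_laurent (LF (lift j k) (lift i l))) => z _; rewrite !mxE.
Qed.

Lemma laurent_mulmx n (F G : C -> 'M[C]_n) :
  laurent_mx F -> laurent_mx G -> laurent_mx (fun z => F z *m G z).
Proof.
move=> LF LG i j; pose S k z := F z i k * G z k j.
have LS k : laurent (S k) by apply: laurentM.
apply: (eq_laurent (laurent_bigsum (index_enum _) xpredT LS)) => z _.
by rewrite mxE.
Qed.

Lemma laurent_adjoint n (F : C -> 'M[C]_n) :
  laurent_mx F -> laurent_mx (fun z => (F z)^t*).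
Proof.
move=> LF i j; apply: (eq_laurent (laurent_conj (LF j i))) => z _.
by rewrite !mxE.
Qed.

(** A coefficient sequence is chosen for each entry; the matrix sequence is
supported in the union of finitely many finite supports. *)
Lemma laurent_mx_symbol n (F : C -> 'M[C]_n) : laurent_mx F ->
  exists M : int -> 'M[C]_n, finitely_supported M /\
    forall z, `|z| = 1 -> F z = mx_symbol M z.
Proof.
move=> LF; pose good (ij : 'I_n * 'I_n) (u : int -> R) := finitely_supported u /\
  forall z : C, `|z| = 1 -> symbol (fun k => (u k)%:C%C) z = F z ij.1 ij.2.
have [b bP] : exists b : 'I_n * 'I_n -> int -> R, forall ij, good ij (b ij).
  by apply: fin_all_exists => -[i j]; apply: laurent_symbol.
pose M k : 'M[C]_n := \matrix_(i, j) (b (i, j) k)%:C%C.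
have fM : finitely_supported M.
  have fU : finite_set (\bigcup_(ij in [set: 'I_n * 'I_n])
                          [set k | b ij k != 0])%classic.
    by apply: bigcup_finite => // ij _; case: (bP ij).
  apply: sub_finite_set fU => k /= Mk.
  have [/existsP [ij bk]|] := boolP [exists ij, b ij k != 0].
    by exists ij.
  rewrite negb_exists => /forallP b0; case/negP: Mk; apply/eqP/matrixP => i j.
  by rewrite !mxE (eqP (negbNE (b0 (i, j)))).
exists M; split=> // z z1; apply/matrixP => i j.
rewrite mx_symbolE //; have [_ <- //] := bP (i, j).
by rewrite /symbol; under [in RHS]eq_fsbigr do rewrite mxE.
Qed.

End LaurentClosure.

(** * The scalar filters: spline generator and its CDF dual *)

Section ScalarFilters.
Variable R : realType.
Local Notation C := R[i].

(** The B-spline mask is a binomial row shifted to start at - floor(m/2). *)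
Definition spline_range (m : nat) : seq int :=
  [seq n%:Z - (m./2)%:Z | n <- iota 0 m.+1].

Lemma spline_range_uniq m : uniq (spline_range m).
Proof. by rewrite map_inj_uniq ?iota_uniq // => i j /addIr []. Qed.

Lemma spline_mask_bin m n : (n <= m)%N ->
  spline_mask R m (n%:Z - (m./2)%:Z) = 2 ^ (1 - m%:Z) * 'C(m, n)%:R.
Proof.
move=> nm; have mE := odd_double_half m.
rewrite /spline_mask subrK absz_nat ifT // uphalf_half.
by apply/andP; split; lia.
Qed.

Lemma spline_mask_out m k : k \notin spline_range m -> spline_mask R m k = 0.
Proof.
move=> ks; rewrite /spline_mask ifF //; apply: contraNF ks => kI.
have mE := odd_double_half m.
have km : (0 <= k + (m./2)%:Z <= m%:Z) by move: kI; rewrite uphalf_half; lia.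
apply/mapP; exists (absz (k + (m./2)%:Z)); last by lia.
by rewrite mem_iota; lia.
Qed.

Definition spline_symbol (m : nat) (z : C) : C :=
  symbol (fun k => (spline_mask R m k)%:C%C) z.

(** The binomial theorem. *)
Lemma spline_symbolE m (z : C) : z != 0 ->
  spline_symbol m z = z ^- m./2 * ((1 + z) / 2) ^+ m.
Proof.
move=> z0; rewrite /spline_symbol /symbol (sum_int_seq (spline_range_uniq m)); last first.
  by move=> k /spline_mask_out ->; rewrite mul0r.
rewrite big_map -[iota 0 m.+1]/(index_iota 0 m.+1) big_mkord.
rewrite exprMn exprDn mulr_suml !mulr_sumr; apply: eq_bigr => n _.
have zn : z ^ (n%:Z - (m./2)%:Z) = z ^+ n / z ^+ m./2.
  by rewrite expfzDr // exprnN.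
have tm : (2 : C) ^ (1 - m%:Z) = 2 / 2 ^+ m.
  by rewrite expfzDr ?pnatr_eq0 // exprnN.
rewrite spline_mask_bin -1?ltnS // zn rmorphM fmorphXz !rmorph_nat tm.
rewrite expr1n mul1r -mulr_natr exprVn.
have : (2 ^+ m : C) != 0 by rewrite expf_neq0 ?pnatr_eq0.
have : z ^+ m./2 != 0 by rewrite expf_neq0.
by move=> h1 h2; field; rewrite h1 mul1r h2.
Qed.

(** For z = e^(it) this is cos(t/2)^2, and cos2 (- z) is sin(t/2)^2. *)
Definition cos2 (z : C) := (2 + z + z^-1) / 4.

Lemma cos2N z : cos2 (- z) = (2 - z - z^-1) / 4.
Proof. by rewrite /cos2 invrN. Qed.

Lemma cos2D z : cos2 z + cos2 (- z) = 1.
Proof. by rewrite cos2N /cos2; move: z^-1 => u; field. Qed.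

(** On the unit circle conjugation replaces z by 1/z, and cos2 z = w (w / z)
with w = (1 + z) / 2.  As m and mt have the same parity, the monomial factors
z^(-floor(m/2)) and z^(floor(mt/2)) compensate exactly for turning the
m + mt linear factors into K copies of cos2 z. *)
Lemma spline_cdf_product m mt (z : C) : ~~ odd (m + mt) -> `|z| = 1 ->
  spline_symbol m z * (cdf_dual_symbol m mt z)^* =
  let K := (m + mt)./2 in
  cos2 z ^+ K * \sum_(n < K) 'C(K.-1 + n, n)%:R * cos2 (- z) ^+ n.
Proof.
move=> mmt z1; have z0 := unit_circle_neq0 z1.
rewrite spline_symbolE // conj_cdf // /cdf_dual_symbol /=.
under eq_bigr do rewrite invrK [2 - z^-1 - z]addrAC -cos2N.
rewrite mulrA; congr (_ * _).
have [] : odd mt = odd m /\ ((m + mt)./2 = odd m + m./2 + mt./2)%N.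
  by have := odd_double_half m; have := odd_double_half mt; lia.
move=> pmt ->; rewrite -exprnN exprVn invrK.
rewrite -[in _ ^+ m](odd_double_half m) -[in _ ^+ mt](odd_double_half mt) pmt.
rewrite !exprD -!mul2n !(exprM _ 2).
have -> : cos2 z = (1 + z) / 2 * ((1 + z) / 2 / z) by rewrite /cos2; field.
have -> : (1 + z^-1) / 2 = (1 + z) / 2 / z by field.
move: ((1 + z) / 2) => w; rewrite !exprMn !exprVn.
have hz n : z ^+ n != 0 by rewrite expf_neq0.
by field; rewrite !hz.
Qed.

Lemma spline_cdf_biorthogonal m mt (z : C) :
  (0 < m)%N -> ~~ odd (m + mt) -> `|z| = 1 ->
  spline_symbol m z * (cdf_dual_symbol m mt z)^* +
  spline_symbol m (- z) * (cdf_dual_symbol m mt (- z))^* = 1.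
Proof.
move=> m0 mmt z1; rewrite !spline_cdf_product ?normrN //= opprK.
(* Here 0 < m enters: K >= 1, so that K.-1 can serve as a and b. *)
have -> : (m + mt)./2 = ((m + mt)./2.-1.+1)%N by lia.
by apply: problem_of_points; exact: cos2D.
Qed.

End ScalarFilters.

(** * The modulation matrix and its inverse *)

Lemma invmxN (K : comUnitRingType) (n : nat) (T : 'M[K]_n) :
  T \in unitmx -> invmx (- T) = - invmx T.
Proof.
move=> Tu; have NTV : - T *m - invmx T = 1%:M by rewrite mulNmx mulmxN opprK mulmxV.
have [NTu _] := mulmx1_unit NTV.
by rewrite -[LHS]mulmx1 -NTV mulmxA mulVmx // mul1mx.
Qed.

Lemma adjointK (K : numClosedFieldType) (n : nat) (M : 'M[K]_n) : M^t*^t* = M.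
Proof. by apply/matrixP => i j; rewrite !mxE conjCK. Qed.

(** The blocks c and c' are scalar, so in this order of the product only
T^-1 A and T^-1 A' occur, and c' T^-1 A - c T^-1 A' = T^-1 T. *)
Lemma block_left_inverse (K : comUnitRingType) (n : nat)
    (A A' : 'M[K]_n) (c c' : K) :
  let T := c' *: A - c *: A' in T \in unitmx ->
  block_mx (c' *: invmx T) (- (invmx T *m A')) (- (c *: invmx T)) (invmx T *m A)
    *m block_mx A A' c%:M c'%:M = 1%:M.
Proof.
move=> T Tu; have TV : c' *: (invmx T *m A) - c *: (invmx T *m A') = 1%:M.
  by rewrite -(mulVmx Tu) /T mulmxBr -!scalemxAr.
rewrite mulmx_block !mul_mx_scalar !mulNmx -!scalemxAl !scalerN.
by rewrite TV subrr addNr addrC TV -scalar_mx_block.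
Qed.

Section QuarkletModulation.
Variables (R : realType) (m p : nat) (b : int -> R).
Local Notation C := R[i].

Lemma quark_mask_finitely_supported : finitely_supported (quark_mask R m p).
Proof.
apply: (@seq_finitely_supported _ _ (spline_range m)) => k /(spline_mask_out R) mk0.
by apply/matrixP => i j; rewrite !mxE mk0 !(mulr0, mul0r).
Qed.

(** The binomial coefficient vanishes above the diagonal. *)
Lemma quark_symbol_trig (z : C) : is_trig_mx (quark_symbol m p z).
Proof.
apply/is_trig_mxP => i j ij; rewrite mx_symbolE; last exact: quark_mask_finitely_supported.
rewrite /symbol fsbig1 ?mulr0 // => k _.
by rewrite mxE bin_small // !(mulr0, mul0r).
Qed.

(** For i = j both powers and the binomial coefficient reduce to 1, at k = 0
included because 0 ^ 0 = 1. *)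
Lemma quark_symbol_diag (z : C) i :
  quark_symbol m p z i i = 2 ^- i * spline_symbol m z.
Proof.
rewrite mx_symbolE; last exact: quark_mask_finitely_supported.
rewrite /spline_symbol /symbol !(sum_int_seq (spline_range_uniq m)).
- rewrite mulrCA; congr (_ * _); rewrite mulr_sumr; apply: eq_bigr => k _.
  rewrite mxE !subrr !expr0z binn !mulr1 mulrA -exprnN rmorphM fmorphV rmorphXn /=.
  by rewrite rmorph_nat.
- by move=> k /spline_mask_out ->; rewrite mul0r.
- by move=> k /(spline_mask_out R) mk0; rewrite mxE mk0 !(mulr0, mul0r).
Qed.

Lemma TmxN (z : C) : Tmx m p b (- z) = - Tmx m p b z.
Proof. by rewrite /Tmx opprK opprB. Qed.

Lemma Tmx_entry (z : C) i j x y :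
  quark_symbol m p z i j = x -> quark_symbol m p (- z) i j = y ->
  Tmx m p b z i j = quarklet_symbol b (- z) * x - quarklet_symbol b z * y.
Proof.
move=> <- <-; rewrite /Tmx.
move: (quark_symbol m p z) (quark_symbol m p (- z)) => A B.
by rewrite !mxE.
Qed.

Lemma Tmx_trig (z : C) : is_trig_mx (Tmx m p b z).
Proof.
apply/is_trig_mxP => i j ij.
have tA (w : C) : quark_symbol m p w i j = 0 by have /is_trig_mxP := quark_symbol_trig w; apply.
by rewrite (Tmx_entry (tA z) (tA (- z))) !mulr0 subr0.
Qed.

Lemma left_inverse_modulation_mx (z : C) : Tmx m p b z \in unitmx ->
  (dual_modulation_mx m p b z)^t* *m modulation_mx m p b z = 1%:M.
Proof.
move=> Tu; have adjA (w : C) : (dual_quark_symbol m p b w)^t* =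
    quarklet_symbol b (- w) *: invmx (Tmx m p b w) by exact: adjointK.
have adjB (w : C) : (dual_quarklet_symbol m p b w)^t* =
    - (invmx (Tmx m p b w) *m quark_symbol m p (- w)) by exact: adjointK.
have adjAN := adjA (- z); rewrite TmxN (invmxN Tu) opprK scalerN in adjAN.
have adjBN := adjB (- z); rewrite TmxN (invmxN Tu) opprK mulNmx opprK in adjBN.
rewrite /dual_modulation_mx tr_block_mx map_block_mx.
rewrite (f_equal4 (@block_mx C _ _ _ _) (adjA z) (adjB z) adjAN adjBN).
exact: (@block_left_inverse _ _ (quark_symbol m p z) (quark_symbol m p (- z))
          (quarklet_symbol b z) (quarklet_symbol b (- z)) Tu).
Qed.

Variable mt : nat.
Hypotheses (m_gt0 : (0 < m)%N) (even_m_mt : ~~ odd (m + mt)).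
Hypothesis b_mask : is_cdf_wavelet_mask m mt b.

(** The wavelet symbol is built so that the scalar determinant
a(z) b(-z) - b(z) a(-z) is z times the left-hand side of
spline_cdf_biorthogonal. *)
Lemma Tmx_diag (z : C) i : `|z| = 1 -> Tmx m p b z i i = 2 ^- i * z.
Proof.
move=> z1; rewrite (Tmx_entry (quark_symbol_diag z i) (quark_symbol_diag (- z) i)).
have -> : quarklet_symbol b (- z) = z * (cdf_dual_symbol m mt z)^*.
  by have := b_mask.2 (- z); rewrite normrN opprK; apply.
have -> : quarklet_symbol b z = - z * (cdf_dual_symbol m mt (- z))^*.
  exact: b_mask.2.
rewrite -[RHS]mulr1 -(spline_cdf_biorthogonal m_gt0 even_m_mt z1).
move: (spline_symbol m z) (spline_symbol m (- z)) => s s'.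
move: (cdf_dual_symbol m mt z)^* => a.
by ring.
Qed.

Lemma det_Tmx (z : C) : `|z| = 1 ->
  \det (Tmx m p b z) = (\prod_(i < p.+1) 2 ^- i) * z ^+ p.+1.
Proof.
move=> z1; rewrite det_trig ?Tmx_trig //.
under eq_bigr do rewrite Tmx_diag //.
by rewrite big_split /= prodr_const card_ord.
Qed.

Lemma Tmx_unit (z : C) : `|z| = 1 -> Tmx m p b z \in unitmx.
Proof.
move=> z1; rewrite unitmxE unitfE det_Tmx // mulf_neq0 //; last first.
  by rewrite expf_neq0 // unit_circle_neq0.
by apply/prodf_neq0 => i _; rewrite invr_neq0 // expf_neq0 // pnatr_eq0.
Qed.

Lemma quarklet_symbol_laurent : laurent (quarklet_symbol b).
Proof. exact: symbol_laurent b_mask.1. Qed.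

Lemma quark_symbol_laurent : laurent_mx (quark_symbol (R:=R) m p).
Proof.
move=> i j; pose u k : R := 2 ^ (- i%:Z) * (uphalf m)%:R ^ (j%:Z - i%:Z) *
  spline_mask R m k * 'C(i, j)%:R * k%:~R ^ (i%:Z - j%:Z).
have fu : finitely_supported u.
  apply: (@seq_finitely_supported _ _ (spline_range m)) => k /(spline_mask_out R).
  by rewrite /u => ->; rewrite !(mulr0, mul0r).
apply: (eq_laurent (symbol_laurent fu)) => z _.
rewrite mx_symbolE; last exact: quark_mask_finitely_supported.
by rewrite /symbol; under [in RHS]eq_fsbigr do rewrite mxE.
Qed.

(** Cramer's rule; the determinant is a monomial, hence invertible among
Laurent polynomials. *)
Lemma invmx_Tmx_laurent : laurent_mx (fun z => invmx (Tmx m p b z)).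
Proof.
have LT : laurent_mx (Tmx m p b).
  move=> i j; have LA := quark_symbol_laurent i j.
  have Lb := quarklet_symbol_laurent.
  apply: (eq_laurent (laurentD (laurentM (laurent_opp_arg Lb) LA)
    (laurentN (laurentM Lb (laurent_opp_arg LA))))) => z _.
  by rewrite (Tmx_entry (erefl _) (erefl _)).
have Ld : laurent (fun z : C => (\prod_(i < p.+1) 2 ^+ i) * z^-1 ^+ p.+1).
  apply: laurentM (laurent_bigprod _ _ _) (laurentXn _ (laurentV R)) => i.
  exact: laurentXn (laurent_nat R 2).
move=> i j; apply: (eq_laurent (laurentM Ld (laurent_adj LT i j))) => z z1.
rewrite /invmx Tmx_unit // [in RHS]mxE; congr (_ * _).
by rewrite det_Tmx // invfM prodfV invrK exprVn.
Qed.

Lemma dual_quark_symbol_laurent : laurent_mx (dual_quark_symbol m p b).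
Proof.
apply: laurent_adjoint => i j.
have L := laurentM (laurent_opp_arg quarklet_symbol_laurent) (invmx_Tmx_laurent i j).
by apply: (eq_laurent L) => z _; rewrite [in RHS]mxE.
Qed.

Lemma dual_quarklet_symbol_laurent : laurent_mx (dual_quarklet_symbol m p b).
Proof.
apply: laurent_adjoint => i j.
have LAN : laurent_mx (fun z : C => quark_symbol m p (- z)).
  by move=> k l; exact: laurent_opp_arg (quark_symbol_laurent k l).
have L := laurentN (laurent_mulmx invmx_Tmx_laurent LAN i j).
by apply: (eq_laurent L) => z _; rewrite [in RHS]mxE.
Qed.

End QuarkletModulation.

Theorem theorem4p11 (R : realType) (m mt p : nat) (b : int -> R)
    (m_gt0 : (0 < m)%N) (mt_gt0 : (0 < mt)%N) (le_m_mt : (m <= mt)%N)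
    (even_m_mt : ~~ odd (m + mt)) (b_mask : is_cdf_wavelet_mask m mt b) :
  (forall z : R[i], `|z| = 1 ->
     [/\ modulation_mx m p b z \in unitmx,
         invmx (modulation_mx m p b z) = (dual_modulation_mx m p b z) ^t*,
         (dual_modulation_mx m p b z) ^t* =
           block_mx ((dual_quark_symbol m p b z) ^t*)
                    ((dual_quarklet_symbol m p b z) ^t*)
                    ((dual_quark_symbol m p b (- z)) ^t*)
                    ((dual_quarklet_symbol m p b (- z)) ^t*)
       & modulation_mx m p b z *m (dual_modulation_mx m p b z) ^t* = 1%:M])
  /\
  (exists At Bt : int -> 'M[R[i]]_p.+1,
     [/\ finitely_supported At, finitely_supported Bt
       & forall z : R[i], `|z| = 1 ->
           dual_quark_symbol m p b z = mx_symbol At z /\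
           dual_quarklet_symbol m p b z = mx_symbol Bt z]).
Proof.
split=> [z z1|].
  have YX := left_inverse_modulation_mx (Tmx_unit p m_gt0 even_m_mt b_mask z1).
  have XY := mulmx1C YX; have [Xu _] := mulmx1_unit XY.
  split=> //; last by rewrite /dual_modulation_mx tr_block_mx map_block_mx.
  by rewrite -[LHS]mul1mx -YX mulmxK.
have [At [fA AE]] := laurent_mx_symbol (dual_quark_symbol_laurent (p := p) m_gt0 even_m_mt b_mask).
have [Bt [fB BE]] := laurent_mx_symbol (dual_quarklet_symbol_laurent (p := p) m_gt0 even_m_mt b_mask).
by exists At, Bt; split=> // z z1; split; [exact: AE | exact: BE].
Qed.
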